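(* Let $y,z\in H^{>}$ and $L<R$, $b_0,b_1>0$ be real numbers such that $y(t)=z(t)=t+b_0$ for $t\in(-\infty,L]$ and $y(t)=z(t)=t+b_1$ for $t\in[R,+\infty)$, and let $\overline{y}^{\infty},\overline{z}^{\infty}\colon C_0\to C_1$ be the corresponding Mather invariants. Then $y$ and $z$ are conjugate in $H$ if and only if $\overline{y}^{\infty}$ and $\overline{z}^{\infty}$ differ by rotations of the domain and range circles, i.e. if and only if there are $\ell,m\in\mathbb{R}$ such that $$v_{1,m}\circ\overline{z}^{\infty}=\overline{y}^{\infty}\circ v_{0,\ell},$$ where $v_{0,\ell}$ is the rotation of $C_0$ by $\ell$ and $v_{1,m}$ is the rotation of $C_1$ by $m$.
   Context: Monod's group $H=H(\mathbb{R})$: the group, under composition, of all homeomorphisms $f$ of $\mathbb{R}\mathrm{P}^1=\mathbb{R}\cup\{\infty\}$ with $f(\infty)=\infty$ for which there are finitely many real points $t_0<\dots<t_n$ such that on each of $(-\infty,t_0]$, $[t_i,t_{i+1}]$, $[t_n,+\infty)$ the map $f$ coincides with a Möbius transformation $t\mapsto\frac{at+b}{ct+d}$, $a,b,c,d\in\mathbb{R}$, $ad-bc=1$. Elements of $H$ are regarded as increasing homeomorphisms of $\mathbb{R}$; they are affine near $\pm\infty$. $H^{>}=\{g\in H\mid g(t)>t\text{ for all }t\in\mathbb{R}\}$. Construction of the Mather invariants. Let $N\in\mathbb{Z}_{>0}$ be large enough that $y^{N}((y^{-1}(L),L))\cup z^{N}((z^{-1}(L),L))\subset(R,+\infty)$.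 Define $s\in H$ by: $s(t)=\frac{t-L}{b_0}$ for $t\in(-\infty,L]$; $s(t)=\frac{t-y^{j}(L)}{y^{j+1}(L)-y^{j}(L)}+j$ for $t\in[y^{j}(L),y^{j+1}(L)]$, $j=0,\dots,N-2$; and $s(t)=\frac{t-y^{N-1}(L)}{b_1}+N-1$ for $t\in[y^{N-1}(L),+\infty)$. Thus $s(y^k(L))=k$ for all $k\in\mathbb{Z}$. Put $\overline{y}=sys^{-1}$ and $\overline{z}=szs^{-1}$; both equal $t\mapsto t+1$ on $(-\infty,-1]$ and on $[N-1,+\infty)$. Let $C_0=(-\infty,0]/(t\sim t+1)$ and $C_1=[N-1,+\infty)/(t\sim t+1)$, both circles of length $1$. The Mather invariant $\overline{y}^{\infty}\colon C_0\to C_1$ is the homeomorphism defined by $\overline{y}^{\infty}([t])=[\overline{y}^{M}(t)]$ for $t\in[-1,0]$, where $M$ is any integer large enough that $\overline{y}^{M}([-1,0])\subset[N-1,+\infty)$ (the result does not depend on $M$); $\overline{z}^{\infty}$ is defined in the same way from $\overline{z}$ (with the same $s$, $C_0$, $C_1$). Rotations are $v_{0,\ell}([t])=[t+\ell]$ on $C_0$ and $v_{1,m}([t])=[t+m]$ on $C_1$, classes being taken modulo $1$. *)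

(* Defs.v *)
From HB Require Import structures.
From mathcomp Require Import all_boot all_order all_algebra.
From mathcomp Require Import all_classical all_reals all_analysis.
From mathcomp Require Import ring lra zify.
Import Order.TTheory GRing.Theory Num.Theory.
Import numFieldNormedType.Exports.

Set Implicit Arguments.
Unset Strict Implicit.
Unset Printing Implicit Defensive.

Local Open Scope classical_set_scope.
Local Open Scope ring_scope.
Local Open Scope quotient_scope.

Definition homeomorphism (T U : topologicalType) (f : T -> U) : Prop :=
  exists g : U -> T, [/\ cancel f g, cancel g f, continuous f & continuous g].

(* The inverse map of a bijection f. *)
Definition inverse (K : realType) (f : K -> K) : K -> K := pinv [set: K] f.

Section MonodGroup.
Variable K : realType.

(* The real projective line; None is the point at infinity. *)
Definition RP1 : topologicalType := one_point_compactification K.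

Definition moebius (a b c d : K) (p : RP1) : RP1 :=
  match p with
  | Some t => if c * t + d == 0 then None else Some ((a * t + b) / (c * t + d))
  | None => if c == 0 then None else Some (a / c)
  end.

(* A self-map of the real line, extended to RP1 by fixing infinity. *)
Definition extend (f : K -> K) : RP1 -> RP1 := omap f.

Definition moebius_on (A : set K) (f : K -> K) : Prop :=
  exists a b c d : K, a * d - b * c = 1 /\
    forall t, A t -> extend f (Some t) = moebius a b c d (Some t).

Definition piecewise_moebius (f : K -> K) : Prop :=
  exists (n : nat) (t : nat -> K),
  [/\ forall i, (i < n)%N -> t i < t i.+1,
      moebius_on `]-oo, t 0%N] f,
      forall i, (i < n)%N -> moebius_on `[t i, t i.+1] f
    & moebius_on `[t n, +oo[ f].

(* Elements of H are represented by their restrictions to the real line. *)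
Definition monodH : set (K -> K) :=
  [set f | homeomorphism (extend f) /\ piecewise_moebius f].

Definition monodH_pos : set (K -> K) :=
  [set g | monodH g /\ forall t, t < g t].

Definition conjugate_in_H (y z : K -> K) : Prop :=
  exists2 h, monodH h & z = h \o y \o inverse h.

End MonodGroup.

Section Circles.
Variable K : realType.

(* For a half-line D, the relation generated by t ~ t + 1 on D. *)
Definition mod1 (D : set K) : rel D :=
  fun t u => set_val t - set_val u \is a Num.int.

Lemma mod1_equiv (D : set K) : equiv_class_of (@mod1 D).
Proof.
split=> [t|t u|t u v]; rewrite /mod1.
- by rewrite subrr rpred0.
- by rewrite -opprB rpredN.
- by move=> tu uv; rewrite -(subrKA (set_val t)) rpredD.
Qed.

Canonical mod1_equivrel (D : set K) := EquivRelPack (mod1_equiv D).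

Definition circle (D : set K) := quotient_topology {eq_quot (mod1_equivrel D)}.

Lemma circle_eqP (D : set K) (t u : D) :
  (\pi_(circle D) t = \pi_(circle D) u) <->
  (set_val t - set_val u \is a Num.int).
Proof. by split=> [/eqmodP|tu]; last apply/eqmodP. Qed.

Definition ray0 : set K := `]-oo, 0].
Definition ray1 (N : nat) : set K := `[N.-1%:R, +oo[.

Definition C0 := circle ray0.
Definition C1 (N : nat) := circle (ray1 N).

(* Representatives of t modulo 1 in ]-1, 0] and in [N-1, N[. *)
Definition red0 (t : K) : K := t - (Num.ceil t)%:~R.
Definition red1 (N : nat) (t : K) : K := N.-1%:R + (t - (Num.floor t)%:~R).

Lemma red0_ray (t : K) : red0 t \in ray0.
Proof. by rewrite inE /ray0/= in_itv/= subr_le0 Num.Theory.ceil_ge. Qed.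

Lemma red1_ray (N : nat) (t : K) : red1 N t \in ray1 N.
Proof.
by rewrite inE /ray1/= in_itv/= andbT lerDl subr_ge0 Num.Theory.floor_le.
Qed.

(* The class [t] modulo 1, for an arbitrary real t. *)
Definition cls0 (t : K) : C0 := \pi_C0 (exist _ (red0 t) (red0_ray t)).
Definition cls1 (N : nat) (t : K) : C1 N :=
  \pi_(C1 N) (exist _ (red1 N t) (red1_ray N t)).

Lemma red0_int (t : K) : red0 t - t \is a Num.int.
Proof. by rewrite /red0 addrAC subrr sub0r rpredN intr_int. Qed.

Lemma red1_int (N : nat) (t : K) : red1 N t - t \is a Num.int.
Proof.
have -> : red1 N t - t = N.-1%:R - (Num.floor t)%:~R by rewrite /red1; ring.
by rewrite rpredB ?intr_int// rpred_nat.
Qed.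

Lemma cls0E (t : ray0) : cls0 (set_val t) = \pi_C0 t.
Proof. exact/circle_eqP/red0_int. Qed.

Lemma cls1E (N : nat) (t : ray1 N) : cls1 N (set_val t) = \pi_(C1 N) t.
Proof. exact/circle_eqP/red1_int. Qed.

Lemma cls0_eqP (t u : K) : cls0 t = cls0 u <-> t - u \is a Num.int.
Proof.
rewrite /cls0 circle_eqP.
change (red0 t - red0 u \is a Num.int <-> t - u \is a Num.int).
have -> : red0 t - red0 u = (t - u) + ((red0 t - t) - (red0 u - u)) by ring.
by rewrite rpredDr// rpredB ?red0_int.
Qed.

Lemma cls1_eqP (N : nat) (t u : K) :
  cls1 N t = cls1 N u <-> t - u \is a Num.int.
Proof.
rewrite /cls1 circle_eqP.
change (red1 N t - red1 N u \is a Num.int <-> t - u \is a Num.int).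
have -> : red1 N t - red1 N u = (t - u) + ((red1 N t - t) - (red1 N u - u)).
  by ring.
by rewrite rpredDr// rpredB ?red1_int.
Qed.

(* A real representative of a class. *)
Definition lift_circle (D : set K) (c : circle D) : K := set_val (repr c).

Definition rotC0 (l : K) (c : C0) : C0 := cls0 (lift_circle c + l).
Definition rotC1 (N : nat) (m : K) (c : C1 N) : C1 N :=
  cls1 N (lift_circle c + m).

Lemma cls0K (c : C0) : cls0 (lift_circle c) = c.
Proof. by rewrite cls0E reprK. Qed.

Lemma cls1K (N : nat) (c : C1 N) : cls1 N (lift_circle c) = c.
Proof. by rewrite cls1E reprK. Qed.

Lemma rotC0E (l t : K) : rotC0 l (cls0 t) = cls0 (t + l).
Proof.
by apply/cls0_eqP; rewrite opprD addrACA subrr addr0; apply/cls0_eqP; rewrite cls0K.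
Qed.

Lemma rotC1E (N : nat) (m t : K) : rotC1 m (cls1 N t) = cls1 N (t + m).
Proof.
by apply/cls1_eqP; rewrite opprD addrACA subrr addr0; apply/(cls1_eqP N); rewrite cls1K.
Qed.

End Circles.

Arguments rotC1 {K} N m c.

Section MatherInvariant.
Variable K : realType.

Section Chart.
Variables (y : K -> K) (L b0 b1 : K).

(* The map s is built by gluing its pieces from left to right: the j-th piece
   starts at y^(j-1)(L), and chart_upto j is s on ]-oo, y^j(L)]. *)
Fixpoint chart_upto (n : nat) (t : K) : K :=
  if n is j.+1 then
    if t <= iter j y L then chart_upto j t
    else (t - iter j y L) / (iter j.+1 y L - iter j y L) + j%:R
  else (t - L) / b0.

Definition chart (N : nat) (t : K) : K :=
  if t <= iter N.-1 y L then chart_upto N.-1 t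
  else (t - iter N.-1 y L) / b1 + N.-1%:R.

Hypothesis ygt : forall t, t < y t.

Lemma chart_iter_mono (i j : nat) : (i <= j)%N -> iter i y L <= iter j y L.
Proof.
move=> /subnK <-; elim: (j - i)%N => [//|k IH].
by rewrite addSn (le_trans IH)// ltW//= ygt.
Qed.

Lemma chart_upto_iter (n : nat) : chart_upto n (iter n y L) = n%:R.
Proof.
case: n => [|n] /=; first by rewrite subrr mul0r.
by rewrite leNgt ygt /= divff ?subr_eq0 ?gt_eqF// nat1r.
Qed.

Lemma chart_upto_widen (n k : nat) (t : K) : t <= iter n y L ->
  chart_upto (k + n) t = chart_upto n t.
Proof.
move=> tn; elim: k => [//|k IH]; rewrite addSn /= IH ifT//.
by rewrite (le_trans tn)// chart_iter_mono// leq_addl.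
Qed.

Lemma chartE_left (N : nat) (t : K) : t <= L -> chart N t = (t - L) / b0.
Proof.
move=> tL; rewrite /chart ifT; last first.
  exact: le_trans tL (chart_iter_mono (leq0n _)).
by rewrite -[N.-1]addn0 chart_upto_widen.
Qed.

Lemma chartE_mid (N j : nat) (t : K) : (j.+1 < N)%N ->
  iter j y L <= t <= iter j.+1 y L ->
  chart N t = (t - iter j y L) / (iter j.+1 y L - iter j y L) + j%:R.
Proof.
move=> jN /andP[jt tj]; have jN1 : (j.+1 <= N.-1)%N by case: N jN.
rewrite /chart ifT; last exact: le_trans tj (chart_iter_mono jN1).
rewrite -(subnK jN1) chart_upto_widen//=; case: ifPn => // tj'.
have -> : t = iter j y L by apply/le_anti; rewrite jt tj'.
by rewrite chart_upto_iter subrr mul0r add0r.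
Qed.

Lemma chartE_right (N : nat) (t : K) : iter N.-1 y L <= t ->
  chart N t = (t - iter N.-1 y L) / b1 + N.-1%:R.
Proof.
move=> Nt; rewrite /chart; case: ifPn => // tN.
have -> : t = iter N.-1 y L by apply/le_anti; rewrite Nt tN.
by rewrite chart_upto_iter subrr mul0r add0r.
Qed.

End Chart.

Definition mather_exponent (N : nat) (f : K -> K) : set nat :=
  [set M | iter M f @` `[-1, 0] `<=` @ray1 K N].

(* The map [t] |-> [f^M(t)], t in [-1, 0]; M is chosen arbitrarily. *)
Definition mather (N : nat) (f : K -> K) (c : C0 K) : C1 K N :=
  cls1 N (iter (xget 0%N (mather_exponent N f)) f (red0 (lift_circle c))).

Lemma mather_stable (N : nat) (f : K -> K) (M k : nat) (t : K) :
  (forall u, N.-1%:R <= u -> f u = u + 1) -> N.-1%:R <= iter M f t ->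
  iter (k + M) f t = iter M f t + k%:R.
Proof.
move=> f1 tM; elim: k => [|k IH]; first by rewrite addr0.
rewrite addSn /= IH f1 ?(le_trans tM) ?lerDl//.
by rewrite -addrA natr1.
Qed.

Lemma mather_indep (N : nat) (f : K -> K) (M M' : nat) (t : K) :
  (forall u, N.-1%:R <= u -> f u = u + 1) ->
  N.-1%:R <= iter M f t -> N.-1%:R <= iter M' f t ->
  cls1 N (iter M f t) = cls1 N (iter M' f t).
Proof.
move=> f1; wlog MM' : M M' / (M <= M')%N => [H tM tM'|tM _].
  have [MM'|/ltnW MM'] := leqP M M'; first exact: H.
  by apply/esym/H.
rewrite -(subnK MM') (mather_stable _ f1)//; apply/cls1_eqP.
by rewrite opprD addrA subrr sub0r rpredN rpred_nat.
Qed.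

(* The definition of mather does not depend on the choices of M and t. *)
Lemma matherE (N : nat) (f : K -> K) (M : nat) (t : K) :
  f (-1) = 0 -> (forall u, N.-1%:R <= u -> f u = u + 1) ->
  mather_exponent N f M -> -1 <= t <= 0 ->
  mather N f (cls0 t) = cls1 N (iter M f t).
Proof.
move=> f0 f1 fM tI; rewrite /mather; set M0 := xget _ _.
have fM0 : mather_exponent N f M0 by exact: (xgetI _ fM).
have big P u : mather_exponent N f P -> -1 <= u <= 0 -> N.-1%:R <= iter P f u.
  move=> fP uI; have : (iter P f @` `[-1, 0]) (iter P f u).
    by exists u => //=; rewrite in_itv.
  by move=> /fP; rewrite /ray1 /= in_itv /= andbT.
set v := red0 _.
have /andP[v1 v0] : -1 < v <= 0.
  rewrite /v /red0; set w := lift_circle _.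
  have := Num.Theory.ceil_itv w; rewrite intrD => /andP[]; lra.
have vt : v - t \is a Num.int.
  rewrite -(subrKA (lift_circle (cls0 t))) rpredD ?red0_int//.
  by apply/cls0_eqP; rewrite cls0K.
have /andP[t1 t0] := tI.
have [k vtk] := intrP vt.
have vtE : t = v \/ (t = -1 /\ v = 0).
  have k1 : (k <= 1)%R by rewrite -(ler_int K) -vtk; lra.
  have k0 : (-1 < k)%R by rewrite -(ltr_int K) -vtk; lra.
  have : k = 0 \/ k = 1 by lia.
  by case=> kE; rewrite kE in vtk; [left|right; split]; lra.
have vI : -1 <= v <= 0 by rewrite ltW.
case: vtE => [->|[tE vE]]; first exact: mather_indep (big _ _ _ _) (big _ _ _ _).
have IE P : iter P f v = iter P.+1 f t by rewrite tE iterSr f0 vE.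
rewrite IE; apply: mather_indep => //; last exact: big.
by rewrite -IE; exact: big.
Qed.

End MatherInvariant.

(* Main.v *)
Require Import Defs.
From mathcomp Require Import all_boot all_order all_algebra.
From mathcomp Require Import all_classical all_reals all_analysis.
From mathcomp Require Import ring lra zify.
Import Order.TTheory GRing.Theory Num.Theory.
Import numFieldNormedType.Exports.
Set Implicit Arguments.
Unset Strict Implicit.
Unset Printing Implicit Defensive.
Local Open Scope classical_set_scope.
Local Open Scope ring_scope.

(** If [h] conjugates [y] to [z], then near each end of the line [h] commutes
with a translation; a Moebius map doing so is itself a translation. Hence
[h t = t + c] near -oo and [h t = t + d] near +oo, and [h (y^M x) = z^M (h x)]
with [x] near -oo and [y^M x] near +oo says that the two Mather invariants
differ by rotations.

Conversely, lifting such an equality from the circles to the line gives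
[z^n (x + c) = y^n x + d] for [x] in a fundamental domain near -oo. Then
[h t = z^n (y^-n t + c)], continued by [t + d] to the right of that
domain's image under [y^n], lies in [H] and intertwines [y] and [z]. *)

(** * Möbius pieces and breakpoints *)

Section Moebius.
Variable K : realType.
Implicit Types (A B : set K) (f g : K -> K) (s : seq K).

Lemma moebius_onP A f : moebius_on A f <->
  exists a b c d : K, a * d - b * c = 1 /\
    forall t, A t -> c * t + d != 0 /\ f t = (a * t + b) / (c * t + d).
Proof.
split=> -[a [b [c [d [abcd fE]]]]]; exists a, b, c, d; split=> // t /fE /=.
  by case: ifPn => // _ [].
by case=> /negPf -> ->.
Qed.

Lemma moebius_on_sub A B f : A `<=` B -> moebius_on B f -> moebius_on A f.
Proof.
move=> AB [a [b [c [d [abcd fE]]]]]; exists a, b, c, d; split=> // t /AB.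
exact: fE.
Qed.

Lemma moebius_on_eq A f g : (forall t, A t -> f t = g t) ->
  moebius_on A f -> moebius_on A g.
Proof.
move=> fg [a [b [c [d [abcd fE]]]]]; exists a, b, c, d; split=> // t At.
by rewrite -fE//= fg.
Qed.

Lemma moebius_on_translation A (v : K) : moebius_on A (+%R^~ v).
Proof.
apply/moebius_onP; exists 1, v, 0, 1; split; first by ring.
by move=> t _; rewrite mul0r add0r oner_neq0 mul1r divr1.
Qed.

Lemma moebius_on_comp A f g :
  moebius_on A g -> moebius_on (g @` A) f -> moebius_on A (f \o g).
Proof.
move=> /moebius_onP[a [b [c [d [abcd gE]]]]].
move=> /moebius_onP[a' [b' [c' [d' [abcd' fE]]]]]; apply/moebius_onP.
exists (a' * a + b' * c), (a' * b + b' * d), (c' * a + d' * c),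
  (c' * b + d' * d); split.
  have -> : 1 = (a * d - b * c) * (a' * d' - b' * c') by rewrite abcd abcd' mulr1.
  by ring.
move=> t At; have [t0 gtE] := gE t At.
have [ft0 ftE] : c' * g t + d' != 0 /\ f (g t) = (a' * g t + b') / (c' * g t + d').
  by apply: fE; exists t.
have denE : (c' * a + d' * c) * t + (c' * b + d' * d) =
    (c' * g t + d') * (c * t + d) by rewrite gtE; field.
have den0 : (c' * a + d' * c) * t + (c' * b + d' * d) != 0.
  by rewrite denE mulf_neq0.
split=> //=; rewrite ftE denE gtE; field; rewrite t0 /=.
move: den0; rewrite [X in _ -> X != 0](_ : _ =
  (c' * a + d' * c) * t + (c' * b + d' * d)) //; by ring.
Qed.

Lemma moebius_on_can A f g : {in A, cancel f g} ->
  moebius_on A f -> moebius_on (f @` A) g.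
Proof.
move=> fK /moebius_onP[a [b [c [d [abcd fE]]]]]; apply/moebius_onP.
(* The inverse of a matrix of determinant 1 is its adjugate. *)
exists d, (- b), (- c), a; split; first by rewrite -abcd; ring.
move=> _ [t At <-]; have [t0 ftE] := fE t At.
have denE : - c * f t + a = (c * t + d)^-1.
  rewrite ftE -[RHS]mul1r -abcd; field; exact: t0.
rewrite denE invr_eq0 invrK; split=> //; rewrite fK ?inE// ftE.
transitivity (t * (a * d - b * c)); first by rewrite abcd mulr1.
by field.
Qed.

(* On a convex set the denominator cannot change sign, and the derivative of
   a Moebius map of determinant 1 is 1 / (c t + d)^2. *)
Lemma moebius_on_itv_lt (u v : K) f : u < v -> moebius_on `[u, v] f -> f u < f v.
Proof.
move=> uv /moebius_onP[a [b [c [d [abcd fE]]]]].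
have [u0 fu] : c * u + d != 0 /\ f u = (a * u + b) / (c * u + d).
  by apply: fE; rewrite /= in_itv /=; lra.
have [v0 fv] : c * v + d != 0 /\ f v = (a * v + b) / (c * v + d).
  by apply: fE; rewrite /= in_itv /=; lra.
have prod0 : 0 < (c * u + d) * (c * v + d).
  rewrite lt_neqAle eq_sym mulf_neq0//= leNgt; apply/negP => neg.
  have c0 : c != 0.
    apply/eqP => c0; move: neg; rewrite c0 !mul0r !add0r -expr2.
    by rewrite ltNge sqr_ge0.
  (* A negative product puts the pole [- d / c] strictly between [u] and [v], where the denominator
     is known not to vanish. *)
  have [] := fE (- d / c); last first.
    by rewrite mulrC divfK// addNr eqxx.
  have uE : c * u + d = c * (u - (- d / c)) by field.
  have vE : c * v + d = c * (v - (- d / c)) by field.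
  set r := - d / c in uE vE *.
  have : (u - r) * (v - r) < 0.
    rewrite -(pmulr_rlt0 _ (_ : 0 < c ^+ 2)) ?exprn_even_gt0//.
    by move: neg; rewrite uE vE (_ : _ * _ = c ^+ 2 * ((u - r) * (v - r)))//; ring.
  by rewrite /= in_itv /= => neg'; apply/andP; split; nra.
rewrite -subr_gt0 (_ : _ - _ = (v - u) / ((c * u + d) * (c * v + d))).
  by rewrite divr_gt0// subr_gt0.
transitivity ((a * d - b * c) * (v - u) / ((c * u + d) * (c * v + d))).
  by rewrite fu fv; field; rewrite u0 v0.
by rewrite abcd mul1r.
Qed.

(* The commutation says that (c u + d) (c (u + b) + d) = 1 along A; the second
   difference of this quadratic in u is 2 c^2 b^2, so c = 0. *)
Lemma moebius_on_commute_translation A f (t b : K) : b != 0 ->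
  A t -> A (t + b) -> A (t + b + b) -> A (t + b + b + b) ->
  (forall u, A u -> A (u + b) -> f (u + b) = f u + b) ->
  moebius_on A f -> exists v, forall u, A u -> f u = u + v.
Proof.
move=> b0 At At1 At2 At3 fb /moebius_onP[p [q [c [d [det fE]]]]].
have key u : A u -> A (u + b) -> (c * u + d) * (c * (u + b) + d) = 1.
  move=> Au Aub; have [u0 fu] := fE _ Au; have [u1 fub] := fE _ Aub.
  have := fb _ Au Aub; rewrite fu fub => /eqP; rewrite -subr_eq0.
  rewrite (_ : _ - _ = b * ((p * d - q * c) - (c * u + d) * (c * (u + b) + d)) /
    ((c * u + d) * (c * (u + b) + d))); last by field; rewrite u0 u1.
  rewrite det mulf_eq0 invr_eq0 !mulf_eq0 (negPf u0) (negPf u1) (negPf b0) !orbF /=.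
  by rewrite subr_eq0 => /eqP.
have c0 : c = 0.
  have : 2 * c ^+ 2 * b ^+ 2 = 0.
    transitivity (((c * t + d) * (c * (t + b) + d) -
        (c * (t + b) + d) * (c * (t + b + b) + d)) -
      ((c * (t + b) + d) * (c * (t + b + b) + d) -
        (c * (t + b + b) + d) * (c * (t + b + b + b) + d))); first by ring.
    by rewrite !key// !subrr.
  move/eqP; rewrite -mulrA -exprMn mulf_eq0 pnatr_eq0 /= sqrf_eq0 mulf_eq0.
  by rewrite (negPf b0) orbF => /eqP.
(* With [c = 0] the map is affine; [d * d = 1] and the determinant make its slope 1. *)
have dd : d * d = 1 by have := key _ At At1; rewrite c0 !mul0r !add0r.
have d0 : d != 0 by apply/eqP => d0; move: dd; rewrite d0 mulr0; lra.
have pd : p = d.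
  move: det; rewrite c0 mulr0 subr0 -dd => pd.
  exact: (mulIf d0).
exists (q / d) => u /fE[_ ->]; rewrite c0 mul0r add0r pd; by field.
Qed.

(* The sets on which a map with breakpoints s must be Moebius are arbitrary sets
   not separated by a point of s, rather than the closed intervals between
   consecutive points: composition and inversion then need no reindexing. *)
Definition unsplit s A := forall p, p \in s ->
  (forall u, A u -> u <= p) \/ (forall u, A u -> p <= u).

Definition breakpoints s f := forall A, unsplit s A -> moebius_on A f.

Lemma unsplit_cat s1 s2 A :
  unsplit (s1 ++ s2) A <-> unsplit s1 A /\ unsplit s2 A.
Proof.
split=> [H|[H1 H2] p]; last by rewrite mem_cat => /orP[/H1|/H2].
by split=> p ps; apply: H; rewrite mem_cat ps ?orbT.
Qed.

(** Adjacent pieces share their breakpoint, so monotonicity chains through it; the induction on [s]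
    cuts [[u, v]] at one breakpoint at a time. *)
Lemma breakpoints_lt s f : breakpoints s f -> {homo f : u v / u < v}.
Proof.
(* Restricting to subsets of [[u, v]] lets the induction drop [p], which separates no subset of
   either half. *)
move=> sf u v uv; have {sf} : forall A, A `<=` `[u, v] -> unsplit s A -> moebius_on A f.
  by move=> A _; exact: sf.
elim: s u v uv => [|p s IH] u v uv sf.
  by apply: moebius_on_itv_lt => //; apply: sf.
have cons A : A `<=` `[u, v] -> unsplit s A ->
    (forall w, A w -> w <= p) \/ (forall w, A w -> p <= w) -> moebius_on A f.
  move=> Auv sA pA; apply: sf => // q; rewrite inE => /orP[/eqP->//|].
  exact: sA.
have [up|pu] := ltP u p; last first.
  apply: IH => // A Auv sA; apply: cons => //; right=> w /Auv /=.
  by rewrite in_itv /= => /andP[uw _]; exact: le_trans uw.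
have [pv|vp] := ltP p v; last first.
  apply: IH => // A Auv sA; apply: cons => //; left=> w /Auv /=.
  by rewrite in_itv /= => /andP[_ wv]; exact: le_trans vp.
apply: (@lt_trans _ _ (f p)); apply: IH => // A Auv sA; apply: cons => //.
- by move=> w /Auv /=; rewrite !in_itv /=; lra.
- by left=> w /Auv /=; rewrite in_itv /=; lra.
- by move=> w /Auv /=; rewrite !in_itv /=; lra.
- by right=> w /Auv /=; rewrite in_itv /=; lra.
Qed.

(** A set unsplit by every [t i] lies in a single piece; conversely, sorting a list yields intervals
    that none of its points separates. *)
Lemma piecewise_moebiusP f : piecewise_moebius f <-> exists s, breakpoints s f.
Proof.
split=> [[n [t [tlt fl fm fr]]]|[s sf]].
  exists [seq t i | i <- iota 0 n.+1] => A sA.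
  have {}sA i : (i <= n)%N ->
      (forall u, A u -> u <= t i) \/ (forall u, A u -> t i <= u).
    by move=> i_n; apply: sA; apply: map_f; rewrite mem_iota /= add0n ltnS.
  have [At0|At0] := sA 0%N isT.
    by apply: moebius_on_sub fl => u /At0; rewrite /= in_itv.
  (* Sweep from left to right: [A] has fallen into a piece already, or it lies to the right of
     [t k]. *)
  have : forall k, (k <= n)%N -> moebius_on A f \/ forall u, A u -> t k <= u.
    elim=> [|k IH] kn; first by right.
    have [|Atk] := IH (ltnW kn); first by left.
    have [Atk1|] := sA _ kn; last by right.
    left; apply: moebius_on_sub (fm _ kn) => u Au.
    by rewrite /= in_itv /= Atk ?Atk1.
  case/(_ n (leqnn n)) => // Atn.
  by apply: moebius_on_sub fr => u /Atn; rewrite /= in_itv /= andbT.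
(* [undup] makes the sorted list strictly increasing; the extra point 0 keeps it nonempty, so that
   [t 0] exists. *)
pose s' : seq K := sort <=%R (undup (0 :: s)).
have s'_lt : sorted <%O s' by rewrite sort_lt_sorted undup_uniq.
have s'_le : sorted <=%O s' by exact: sort_le_sorted.
have s's p : p \in s -> p \in s'.
  by move=> ps; rewrite mem_sort mem_undup inE ps orbT.
have s'0 : (0 < size s')%N.
  have : 0 \in s' by rewrite mem_sort mem_undup mem_head.
  by case: (s').
have s'mono i j : (i <= j)%N -> (j < size s')%N -> nth 0 s' i <= nth 0 s' j.
  move=> ij js; apply: (sorted_leq_nth le_trans lexx) => //.
  by rewrite inE (leq_ltn_trans ij).
exists (size s').-1, (nth 0 s'); split.
- move=> i i_s; apply: (sorted_ltn_nth lt_trans) => //; rewrite inE.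
    exact: leq_trans i_s (leq_pred _).
  by rewrite -ltn_predRL.
- apply: sf => p /s's /(nthP 0)[j js <-]; left=> u.
  by rewrite /= in_itv /= => /le_trans; apply; exact: s'mono.
- move=> i i_s; apply: sf => p /s's /(nthP 0)[j js <-].
  have [ji|ij] := leqP j i; [right|left] => u; rewrite /= in_itv /= => /andP[l r].
    by rewrite (le_trans _ l)// s'mono// (leq_trans i_s)// leq_pred.
  by rewrite (le_trans r)// s'mono.
- apply: sf => p /s's /(nthP 0)[j js <-]; right=> u.
  by rewrite /= in_itv /= andbT; apply: le_trans; apply: s'mono; rewrite -ltnS prednK.
Qed.

End Moebius.

(** * The group H: order-theoretic description and closure properties *)

Section MonodGroupTheory.
Variable K : realType.
Implicit Types (f g h : K -> K).

Lemma inverse_can f : injective f -> (forall v, exists u, f u = v) ->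
  cancel f (inverse f) /\ cancel (inverse f) f.
Proof.
move=> finj fsurj; split=> [u|v]; rewrite /inverse.
  by rewrite pinvKV ?in_setT// => ? ? _ _; exact: finj.
by rewrite pinvK// inE; have [u <-] := fsurj v; exists u.
Qed.

Lemma increasing_can_continuous f g : {homo f : u v / u < v} ->
  cancel f g -> cancel g f -> continuous f.
Proof.
move=> flt fK gK; have fle := le_mono flt; have flt' := leW_mono fle => t.
apply/cvgrPdist_lt => e e0.
have h1 : g (f t - e) < t by rewrite -flt' gK; lra.
have h2 : t < g (f t + e) by rewrite -flt' gK; lra.
have : \forall u \near t, u \in `]g (f t - e), g (f t + e)[.
  by apply: near_in_itvoo; rewrite in_itv /= h1.
apply: filterS => u; rewrite in_itv /= -flt' -[_ < g _]flt' !gK => /andP[l r].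
rewrite ltr_norml; lra.
Qed.

(** Neighbourhoods of infinity are complements of compact sets, and the preimage of a compact set
    under [f] is its image under the continuous [g], again compact. *)
Lemma extend_continuous f g : continuous f -> continuous g ->
  cancel f g -> cancel g f -> continuous (extend f).
Proof.
move=> fc gc fK gK [t|] U /=.
  move=> /fc fU; exact: fU.
case=> W [Wc Wcl] WU; exists (g @` W); first split.
- by apply: continuous_compact => //; exact/continuous_subspaceT.
- apply: compact_closed; first exact: Rhausdorff.
  by apply: continuous_compact => //; exact/continuous_subspaceT.
- move=> _ [[t nWt <-]|->]; apply: WU; last by right.
  left; exists (f t) => // Wft; apply: nWt; exists (f t) => //; exact: fK.
Qed.

(** Removes the topology from membership in H: breakpoints force strict monotonicity, and an
    increasing bijection of the line extends to a homeomorphism. *)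
Lemma monodHP f : monodH f <->
  [/\ {homo f : u v / u < v}, forall v, exists u, f u = v &
      exists s, breakpoints s f].
Proof.
split=> [[[g [fK gK _ _]] /piecewise_moebiusP[s sf]]|[flt fsurj fs]].
  split; [exact: breakpoints_lt sf| |by exists s].
  move=> v; have := gK (Some v); case: (g _) => //= u [<-]; by exists u.
have [fK gK] := inverse_can (inc_inj (le_mono flt)) fsurj.
have fle := le_mono flt; have flt' := leW_mono fle.
have glt : {homo inverse f : u v / u < v} by move=> u v uv; rewrite -flt' !gK.
split; last exact/piecewise_moebiusP.
have fc := increasing_can_continuous flt fK gK.
have gc := increasing_can_continuous glt gK fK.
exists (extend (inverse f)); split.
- by case=> //= u; rewrite fK.
- by case=> //= u; rewrite gK.
- exact: extend_continuous fc gc fK gK.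
- exact: extend_continuous gc fc gK fK.
Qed.

Section monodH_lemmas.
Variable f : K -> K.
Hypothesis fH : monodH f.

Lemma monodH_lt : {mono f : u v / u < v}.
Proof. by have /monodHP[/le_mono/leW_mono] := fH. Qed.

Lemma monodH_le : {mono f : u v / u <= v}.
Proof. by have /monodHP[/le_mono] := fH. Qed.

Lemma monodHK : cancel f (inverse f).
Proof. by have /monodHP[_ /inverse_can[|]//] := fH; exact/inc_inj/monodH_le. Qed.

Lemma monodHKV : cancel (inverse f) f.
Proof. by have /monodHP[_ /inverse_can[|]//] := fH; exact/inc_inj/monodH_le. Qed.

End monodH_lemmas.

Lemma monodH_translation (v : K) : monodH (+%R^~ v).
Proof.
apply/monodHP; split=> [u w uw|u|].
- by rewrite ltrD2r.
- by exists (u - v); rewrite subrK.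
- by exists [::] => A _; exact: moebius_on_translation.
Qed.

Lemma monodH_comp f g : monodH f -> monodH g -> monodH (f \o g).
Proof.
move=> fH gH; have gle := monodH_le gH.
have /monodHP[flt fsurj [s sf]] := fH; have /monodHP[glt gsurj [s' sg]] := gH.
apply/monodHP; split=> [u v uv|w|].
- by apply/flt/glt.
- by have [v <-] := fsurj w; have [u <-] := gsurj v; exists u.
(* The breakpoints of [f] are pulled back through [g], so that [s] does not split the image of
   [A]. *)
exists (s' ++ map (inverse g) s) => A /unsplit_cat[/sg Ag As].
apply: moebius_on_comp Ag _; apply: sf => p ps.
have [Ap|Ap] := As _ (map_f (inverse g) ps); [left|right] => _ [u Au <-].
  by rewrite -[p](monodHKV gH) gle Ap.
by rewrite -[p](monodHKV gH) gle Ap.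
Qed.

Lemma monodH_inverse f : monodH f -> monodH (inverse f).
Proof.
move=> fH; have /monodHP[_ _ [s sf]] := fH.
have fK := monodHK fH; have gK := monodHKV fH; have fle := monodH_le fH.
apply/monodHP; split=> [u v uv|u|].
- by rewrite -(monodH_lt fH) !gK.
- by exists (f u).
exists (map f s) => A As.
have -> : A = f @` (f @^-1` A).
  by apply/seteqP; split=> [u Au|_ [u Afu <-]//]; exists (inverse f u); rewrite /= gK.
apply: moebius_on_can => [u _|]; first exact: fK.
apply: sf => p ps; have [Ap|Ap] := As _ (map_f f ps); [left|right] => u /Ap.
  by rewrite fle.
by rewrite fle.
Qed.

Lemma monodH_iter f n : monodH f -> monodH (iter n f).
Proof.
move=> fH; elim: n => [|n IH]; last exact: (monodH_comp fH IH).
rewrite (_ : iter 0 f = +%R^~ 0); first exact: monodH_translation.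
by apply/funext => u /=; rewrite addr0.
Qed.

(** Agreement at [p] gives monotonicity across it; [p] joins the breakpoints of both maps. *)
Lemma monodH_glue f g (p : K) : monodH f -> monodH g -> f p = g p ->
  monodH (fun t => if t <= p then f t else g t).
Proof.
move=> fH gH fg; have /monodHP[flt fsurj [s sf]] := fH.
have /monodHP[glt gsurj [s' sg]] := gH.
apply/monodHP; split=> [u v uv|w|].
- case: ifPn => up; case: ifPn => vp; [exact: flt| |lra|exact: glt].
  by apply: (@le_lt_trans _ _ (f p)); rewrite ?(monodH_le fH)// fg glt// ltNge.
- have [wp|pw] := leP w (f p).
    have [u fu] := fsurj w; exists u; rewrite ifT//.
    by rewrite -(monodH_le fH) fu.
  have [u gu] := gsurj w; exists u; rewrite ifF//; apply/negbTE.
  by rewrite -ltNge -(monodH_lt gH) gu -fg.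
exists (p :: s ++ s') => A; rewrite -cat1s => /unsplit_cat[Ap].
move=> /unsplit_cat[/sf Af /sg Ag].
have [{}Ap|{}Ap] := Ap p (mem_head _ _).
  by apply: moebius_on_eq Af => t /Ap ->.
apply: moebius_on_eq Ag => t /Ap; rewrite le_eqVlt => /orP[/eqP<-|].
  by rewrite lexx.
by rewrite ltNge => /negPf->.
Qed.

End MonodGroupTheory.

Lemma monodH_affine (K : realType) (a b : K) : 0 < a ->
  monodH (fun t => a * t + b).
Proof.
move=> a0; have a0' : a != 0 by rewrite gt_eqF.
apply/monodHP; split=> [u v uv|w|].
- by rewrite ltrD2r ltr_pM2l.
- by exists ((w - b) / a); field.
exists [::] => A _; apply/moebius_onP.
have r0 : Num.sqrt a != 0 by rewrite gt_eqF// sqrtr_gt0.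
have r2 : Num.sqrt a ^+ 2 = a by rewrite sqr_sqrtr// ltW.
(* The matrix with rows [a, b] and [0, 1] is divided by the square root of its determinant. *)
exists (Num.sqrt a), (b / Num.sqrt a), 0, (Num.sqrt a)^-1; split; first by field.
move=> t _; rewrite mul0r add0r invr_eq0; split=> //.
by rewrite -{1}r2; field.
Qed.

(** * Orbits of a map that is a translation near both ends *)

Section Dynamics.
Variables (K : realType) (f : K -> K) (L R b0 b1 : K).
Hypotheses (fP : monodH_pos f) (b0_gt0 : 0 < b0) (b1_gt0 : 0 < b1).
Hypothesis fL : forall t, t <= L -> f t = t + b0.
Hypothesis fR : forall t, R <= t -> f t = t + b1.

Lemma iter_left (k : nat) (t : K) : t + k%:R * b0 <= L ->
  iter k f t = t + k%:R * b0.
Proof.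
have b0p := b0_gt0; elim: k => [|k IH]; first by rewrite mul0r addr0.
rewrite -natr1 mulrDl mul1r => tL; have tL' : t + k%:R * b0 <= L by lra.
by rewrite /= IH// fL//; ring.
Qed.

Lemma iter_right (k : nat) (t : K) : R <= t -> iter k f t = t + k%:R * b1.
Proof.
move=> Rt; elim: k => [|k IH]; first by rewrite mul0r addr0.
have k0 : 0 <= k%:R * b1 by rewrite mulr_ge0// ltW.
rewrite /= IH fR; [rewrite -natr1; ring|lra].
Qed.

Lemma iter_exponent_le (m n : nat) (t : K) : (m <= n)%N -> iter m f t <= iter n f t.
Proof. by move=> mn; apply: (chart_iter_mono _ fP.2). Qed.

Lemma iter_le (n : nat) : {mono iter n f : u v / u <= v}.
Proof. exact/monodH_le/monodH_iter/fP.1. Qed.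

Lemma iter_lt (n : nat) : {mono iter n f : u v / u < v}.
Proof. exact/monodH_lt/monodH_iter/fP.1. Qed.

Lemma inverse_left : inverse f L = L - b0.
Proof.
have b0p := b0_gt0; have -> : L = f (L - b0) by rewrite fL ?subrK//; lra.
by rewrite (monodHK fP.1) fL; lra.
Qed.

(** The left endpoint [L - b0] of the open fundamental domain inherits the bound in weak form, and
    [N] steps from it are [N.-1] steps from [L]. *)
Lemma fundamental_domain_escape (N : nat) : (0 < N)%N ->
  iter N f @` `]inverse f L, L[ `<=` `]R, +oo[ -> R <= iter N.-1 f L.
Proof.
move=> N0 fN; have b0p := b0_gt0; have -> : iter N.-1 f L = iter N f (L - b0).
  by case: N N0 {fN} => // n _; rewrite iterSr fL ?subrK//; lra.
rewrite leNgt; apply/negP => lt_R.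
have {}fN u : L - b0 < u < L -> R < iter N f u.
  move=> uI; have : (iter N f @` `]inverse f L, L[) (iter N f u).
    by exists u => //=; rewrite in_itv /= inverse_left.
  by move=> /fN /=; rewrite in_itv /= andbT.
(* A preimage [v] of [R] would lie beyond [L - b0]: inside the domain this gives [R < R], and past
   it the midpoint lands at most at [R]. *)
have /monodHP[_ /(_ R)[v vR] _] := monodH_iter N fP.1.
have Lv : L - b0 < v by rewrite -(iter_lt N) vR.
have [vL|vL] := ltP v L.
  by have := fN v; rewrite vR ltxx Lv vL => /(_ isT).
have : R < iter N f (L - b0 / 2) by apply: fN; lra.
have : iter N f (L - b0 / 2) <= R by rewrite -vR iter_le; lra.
lra.
Qed.

Lemma nat_upper_bound (x : K) : exists n : nat, x <= n%:R.
Proof.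
exists (Num.bound `|x|); apply: le_trans (ler_norm x) _.
exact/ltW/archi_boundP.
Qed.

Lemma iter_unbounded (n : nat) (x B : K) : R <= iter n f L ->
  exists M0, forall M, (M0 <= M)%N -> B <= iter M f x.
Proof.
move=> RnL; have b0p := b0_gt0; have b1p := b1_gt0; have [j jx] := nat_upper_bound ((L - x) / b0).
have [i iB] := nat_upper_bound ((B - R) / b1).
(* From [L - j%:R * b0], a point left of [x]: [j] steps reach [L], [n] more reach [R], and [i]
   translations by [b1] pass [B]. *)
exists (i + (n + j))%N => M iM; apply: le_trans (iter_exponent_le _ iM).
have jx' : L - j%:R * b0 <= x by move: jx; rewrite ler_pdivrMr//; lra.
have iB' : B - R <= i%:R * b1 by move: iB; rewrite ler_pdivrMr.
have {}jx' : iter (i + (n + j)) f (L - j%:R * b0) <= iter (i + (n + j)) f x.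
  by rewrite iter_le.
apply: le_trans jx'.
rewrite !iterD (iter_left (k := j)); last by rewrite subrK.
by rewrite subrK iter_right//; lra.
Qed.

End Dynamics.

(** * Mather invariants in the original coordinate *)

Section MatherFormula.
Variables (K : realType) (y f : K -> K) (L R b0 b1 : K) (N : nat).
Hypotheses (yP : monodH_pos y) (fP : monodH_pos f).
Hypotheses (b0_gt0 : 0 < b0) (b1_gt0 : 0 < b1).
Hypothesis fL : forall t, t <= L -> f t = t + b0.
Hypothesis fR : forall t, R <= t -> f t = t + b1.
Hypothesis yN : R <= iter N.-1 y L.
Hypothesis fN : R <= iter N.-1 f L.

Let s := chart y L b0 b1 N.
Let P := iter N.-1 y L.
Let fbar := s \o f \o inverse s.

Lemma monodH_chart : monodH s.
Proof.
have affine (a b c : K) : 0 < a -> monodH (fun t => (t - c) / a + b).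
  move=> a0; rewrite (_ : (fun t => _) = fun t => a^-1 * t + (b - c / a)).
    by apply: monodH_affine; rewrite invr_gt0.
  by apply/funext => t; ring.
rewrite /s /chart.
have upto n : monodH (chart_upto y L b0 n).
  elim: n => [|n IH] /=.
    have := affine b0 0 L b0_gt0; congr (monodH _).
    by apply/funext => t; rewrite addr0.
  apply: monodH_glue IH _ _; first by apply: affine; rewrite subr_gt0 yP.2.
  by rewrite chart_upto_iter ?subrr ?mul0r ?add0r//; exact: yP.2.
apply: monodH_glue (upto _) _ _; first exact: affine.
by rewrite chart_upto_iter ?subrr ?mul0r ?add0r//; exact: yP.2.
Qed.

Let sL t : t <= L -> s t = (t - L) / b0.
Proof. exact: (chartE_left _ _ yP.2). Qed.

Let sR t : P <= t -> s t = (t - P) / b1 + N.-1%:R.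
Proof. exact: (chartE_right _ _ yP.2). Qed.

Let sP : s P = N.-1%:R.
Proof. by rewrite sR// subrr mul0r add0r. Qed.

Let sVL t : t <= 0 -> inverse s t = L + b0 * t.
Proof.
move=> t0; have b0p := b0_gt0; have b0' : b0 != 0 by rewrite gt_eqF.
have {1}-> : t = s (L + b0 * t) by rewrite sL; [field|nra].
exact/monodHK/monodH_chart.
Qed.

Let iter_fbar n t : iter n fbar t = s (iter n f (inverse s t)).
Proof.
elim: n => [|n IH] /=; first by rewrite (monodHKV monodH_chart).
by rewrite IH /fbar /= (monodHK monodH_chart).
Qed.

(* The Mather invariant of [sfs^-1] in the original coordinate. *)
Lemma matherE_iter (M : nat) (t : K) : t <= 0 -> P <= iter M f (L + b0 * t) ->
  mather N fbar (cls0 t) = cls1 N ((iter M f (L + b0 * t) - P) / b1).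
Proof.
move=> t0 PM; have b0p := b0_gt0; have b1p := b1_gt0; have b1' : b1 != 0 by rewrite gt_eqF.
have [M0 M0P] := iter_unbounded fP b0_gt0 b1_gt0 fL fR (L - b0) P fN.
have /andP[ct1 ct0] := Num.Theory.ceil_itv t.
have [k ck] : exists k : nat, Num.ceil t = - (k%:Z).
  have : (Num.ceil t <= 0)%R by rewrite ceil_le0.
  by exists `|Num.ceil t|%N; lia.
rewrite ck rmorphB /= rmorphN /= in ct1; rewrite ck rmorphN /= in ct0.
have ckR : (- k%:Z)%:~R = - k%:R :> K by rewrite rmorphN.
(* [matherE] takes a representative in [[-1, 0]], obtained by subtracting the ceiling. *)
pose v := t + k%:R.
have -> : cls0 t = cls0 v by apply/cls0_eqP; rewrite opprD addNKr rpredN rpred_nat.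
have vI : -1 <= v <= 0 by rewrite /v; lra.
have big u : -1 <= u -> P <= iter (M0 + M) f (L + b0 * u).
  move=> u1; apply: (le_trans (M0P (M0 + M)%N (leq_addr _ _))).
  by rewrite iter_le//; nra.
have bar0 : fbar (-1) = 0.
  rewrite /fbar /= sVL ?lerN10// fL; last lra.
  by rewrite sL; [field; rewrite gt_eqF|lra].
have bar1 u : N.-1%:R <= u -> fbar u = u + 1.
  move=> Nu; have PVu : P <= inverse s u.
    by rewrite -(monodH_le monodH_chart) sP (monodHKV monodH_chart).
  rewrite /fbar /= fR; last exact: le_trans PVu.
  rewrite -{2}[u](monodHKV monodH_chart) !sR//; [by field|lra].
have expM : mather_exponent N fbar (M0 + M)%N.
  move=> _ [u uI <-]; move: uI; rewrite /= in_itv /= => /andP[u1 u0].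
  rewrite /ray1 /= in_itv /= andbT iter_fbar sVL// -sP.
  by rewrite (monodH_le monodH_chart) big.
rewrite (matherE bar0 bar1 expM vI) iter_fbar sVL; last by have /andP[] := vI.
have vE : L + b0 * v = iter k f (L + b0 * t).
  rewrite (iter_left b0_gt0 fL) /v; first by ring.
  by have /andP[_] := vI; rewrite /v; nra.
(* Going from [t] to [v] takes [k] steps, so there are [M0 + k] steps beyond the [M] given; each
   adds [b1], an integer after division by [b1]. *)
have -> : iter (M0 + M) f (L + b0 * v) = iter M f (L + b0 * t) + (M0 + k)%:R * b1.
  rewrite vE -iterD -(iter_right b1_gt0 fR _ (le_trans yN PM)) -iterD.
  by congr iter; lia.
rewrite sR; last first.
  by rewrite (le_trans PM)// lerDl mulr_ge0// ltW.
apply/cls1_eqP; rewrite (_ : _ - _ = (M0 + k + N.-1)%:R) ?rpred_nat//.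
by rewrite !natrD; field.
Qed.

End MatherFormula.

(** * Intertwiners near the two ends *)

Section TranslationGerms.
Variable K : realType.
Implicit Types y z h : K -> K.

Lemma intertwiner_left y z h (L b : K) : monodH h -> 0 < b ->
  (forall t, t <= L -> y t = t + b) -> (forall t, t <= L -> z t = t + b) ->
  h \o y = z \o h -> exists c T, forall t, t <= T -> h t = t + c.
Proof.
move=> hH b0 yL zL hyz; have [_ [n [t [_ hl _ _]]]] := hH.
(* Left of [T], [h] has a single Möbius formula and its values stay below [L], where [z] is a
   translation. *)
pose T := Num.min (t 0%N) (Num.min L (inverse h L)).
have [Tt TL Th] : [/\ T <= t 0%N, T <= L & T <= inverse h L].
  by split; rewrite /T !ge_min lexx ?orbT.
have hTle u : u <= T -> h u <= L.
  by move=> uT; rewrite -[L](monodHKV hH) (monodH_le hH) (le_trans uT).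
(* The second difference uses four points spaced by [b], the last of them [T]. *)
have [|||||||c hc] := @moebius_on_commute_translation _ [set u | u <= T] h (T - b - b - b) b.
- by rewrite gt_eqF.
- by rewrite /=; lra.
- by rewrite /=; lra.
- by rewrite /=; lra.
- by rewrite /=; lra.
- move=> u /= uT _; rewrite -yL; last lra.
  by have /= -> := congr1 (@^~ u) hyz; rewrite zL// hTle.
- by apply: moebius_on_sub hl => u /= uT; rewrite in_itv /=; lra.
by exists c, T.
Qed.

Lemma intertwiner_right y z h (R b : K) : monodH h -> 0 < b ->
  (forall t, R <= t -> y t = t + b) -> (forall t, R <= t -> z t = t + b) ->
  h \o y = z \o h -> exists d T, forall t, T <= t -> h t = t + d.
Proof.
move=> hH b0 yR zR hyz; have [_ [n [t [_ _ _ hr]]]] := hH.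
pose T := Num.max (t n) (Num.max R (inverse h R)).
have [tT RT hT] : [/\ t n <= T, R <= T & inverse h R <= T].
  by split; rewrite /T !le_max lexx ?orbT.
have hTle u : T <= u -> R <= h u.
  by move=> Tu; rewrite -[R](monodHKV hH) (monodH_le hH) (le_trans _ Tu).
have [|||||||d hd] := @moebius_on_commute_translation _ [set u | T <= u] h T b.
- by rewrite gt_eqF.
- by rewrite /=; lra.
- by rewrite /=; lra.
- by rewrite /=; lra.
- by rewrite /=; lra.
- move=> u /= Tu _; rewrite -yR; last lra.
  by have /= -> := congr1 (@^~ u) hyz; rewrite zR// hTle.
- by apply: moebius_on_sub hr => u /= Tu; rewrite in_itv /= andbT; lra.
by exists d, T.
Qed.

Lemma conjugate_in_HP y z :
  conjugate_in_H y z <-> exists2 h, monodH h & h \o y = z \o h.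
Proof.
split=> -[h hH hyz]; exists h => //.
  by rewrite hyz; apply/funext => t /=; rewrite (monodHK hH).
by apply/funext => t; rewrite hyz /= (monodHKV hH).
Qed.

Lemma iter_intertwine y z h : h \o y = z \o h ->
  forall n t, h (iter n y t) = iter n z (h t).
Proof.
move=> hyz; elim=> [//|n IH] t /=; rewrite -IH.
exact: (congr1 (@^~ (iter n y t)) hyz).
Qed.

End TranslationGerms.

(** * Conjugacy and equality of invariants up to rotations *)

Section MatherInvariantComplete.
Variables (K : realType) (y z : K -> K) (L R b0 b1 : K) (N : nat).
Hypotheses (yP : monodH_pos y) (zP : monodH_pos z).
Hypotheses (b0_gt0 : 0 < b0) (b1_gt0 : 0 < b1).
Hypothesis yL : forall t, t <= L -> y t = t + b0.
Hypothesis zL : forall t, t <= L -> z t = t + b0.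
Hypothesis yR : forall t, R <= t -> y t = t + b1.
Hypothesis zR : forall t, R <= t -> z t = t + b1.
Hypothesis yN : R <= iter N.-1 y L.
Hypothesis zN : R <= iter N.-1 z L.

Let s := chart y L b0 b1 N.
Let P := iter N.-1 y L.
Let ybar := s \o y \o inverse s.
Let zbar := s \o z \o inverse s.

Let matherY M t : t <= 0 -> P <= iter M y (L + b0 * t) ->
  mather N ybar (cls0 t) = cls1 N ((iter M y (L + b0 * t) - P) / b1).
Proof. exact: (matherE_iter yP yP b0_gt0 b1_gt0 yL yR yN yN). Qed.

Let matherZ M t : t <= 0 -> P <= iter M z (L + b0 * t) ->
  mather N zbar (cls0 t) = cls1 N ((iter M z (L + b0 * t) - P) / b1).
Proof. exact: (matherE_iter yP zP b0_gt0 b1_gt0 zL zR yN zN). Qed.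

Lemma conjugate_mather : conjugate_in_H y z ->
  exists l m : K, rotC1 N m \o mather N zbar = mather N ybar \o rotC0 l.
Proof.
have b0p := b0_gt0; have b1p := b1_gt0.
have b0' : b0 != 0 by rewrite gt_eqF.
have b1' : b1 != 0 by rewrite gt_eqF.
move=> /conjugate_in_HP[h hH hyz].
have [c [T hc]] := intertwiner_left hH b0_gt0 yL zL hyz.
have [d [T' hd]] := intertwiner_right hH b1_gt0 yR zR hyz.
(* The chart scales lengths by [1 / b0] on the left and [1 / b1] on the right. The signs are
   negative because the equation starts from [h x] on the [z] side and returns to [x]. *)
exists (- (c / b0)), (- (d / b1)); apply/funext => q /=; rewrite -[q]cls0K.
set u := lift_circle q; rewrite rotC0E.
(* An integer shift by [j] puts both representatives in the left ray and [x] below [T], where [h]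
   adds [c]. *)
have [j uj] := nat_upper_bound
  (Num.max u (Num.max (u - c / b0) ((L + b0 * (u - c / b0) - T) / b0))).
move: uj; rewrite !ge_max => /and3P[j1 j2]; rewrite ler_pdivrMr// => j3.
pose t := u - j%:R; have -> : cls0 u = cls0 t.
  by apply/cls0_eqP; rewrite opprB addrC subrK rpred_nat.
have -> : cls0 (u - c / b0) = cls0 (t - c / b0).
  by apply/cls0_eqP; rewrite (_ : _ - _ = j%:R) ?rpred_nat// /t; ring.
have [t0 t1] : t <= 0 /\ t - c / b0 <= 0 by rewrite /t; split; lra.
pose x := L + b0 * (t - c / b0).
have xT : x <= T by rewrite /x /t; lra.
have xc : L + b0 * t = h x by rewrite hc// /x; field.
have [M1 yM1] := iter_unbounded yP b0_gt0 b1_gt0 yL yR x (Num.max P T') yN.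
have [M2 zM2] := iter_unbounded zP b0_gt0 b1_gt0 zL zR (L + b0 * t) P zN.
pose M := (M1 + M2)%N.
have := yM1 M (leq_addr _ _); rewrite ge_max => /andP[PyM TyM].
have PzM := zM2 M (leq_addl _ _).
rewrite (matherZ t0 PzM) (matherY t1 PyM) rotC1E; congr cls1.
by rewrite xc -(iter_intertwine hyz) hd// -/x; field.
Qed.

(* Both sides increase by exactly b1 over a fundamental domain of the
   translation by b0, so two lifts of the same circle map differ by a constant
   integer there. *)
Lemma mather_lift (l m : K) :
  rotC1 N m \o mather N zbar = mather N ybar \o rotC0 l ->
  exists c d A n, [/\ A <= L, A + c <= L, R <= iter n y (A - b0),
    R <= iter n z (A - b0 + c) &
    forall x, A - b0 <= x <= A -> iter n z (x + c) = iter n y x + d].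
Proof.
have b0p := b0_gt0; have b1p := b1_gt0.
have b0' : b0 != 0 by rewrite gt_eqF.
have b1' : b1 != 0 by rewrite gt_eqF.
(* For [x <= A] both [x] and [x + c] are at most [L], so [y] and [z] translate them by [b0]. *)
move=> yz; pose c := - (l * b0); pose A := Num.min L (L - c).
have [AL ALc] : A <= L /\ A <= L - c by rewrite /A !ge_min !lexx orbT.
have [M1 yM1] := iter_unbounded yP b0_gt0 b1_gt0 yL yR (A - b0) P yN.
have [M2 zM2] := iter_unbounded zP b0_gt0 b1_gt0 zL zR (A - b0 + c) P zN.
pose n := (M1 + M2)%N.
have PY := yM1 n (leq_addr _ _); have PZ := zM2 n (leq_addl _ _).
have RY := le_trans yN PY; have RZ := le_trans yN PZ.
(* The left endpoint [A - b0] fixes the constant [d]. *)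
exists c, (iter n z (A - b0 + c) - iter n y (A - b0)), A, n; split=> //; first lra.
set Y0 := iter n y _ in PY RY *; set Z0 := iter n z _ in PZ RZ *.
have YA : iter n y A = Y0 + b1.
  by rewrite -yR// -iterS iterSr yL ?subrK//; lra.
have ZA : iter n z (A + c) = Z0 + b1.
  by rewrite -zR// -iterS iterSr zL; [congr iter; ring|lra].
(* The right endpoint is settled separately, leaving strict upper bounds for the other points. *)
move=> x /andP[x1]; rewrite le_eqVlt => /orP[/eqP->|x2].
  by rewrite YA ZA; ring.
have int_diff w : A - b0 <= w <= A ->
    (iter n z (w + c) - iter n y w) / b1 + m \is a Num.int.
  move=> /andP[w1 w2]; pose t := (w + c - L) / b0.
  have t0 : t <= 0 by rewrite /t pmulr_lle0 ?invr_gt0//; lra.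
  have tl : t + l = (w - L) / b0 by rewrite /t /c; field.
  have tl0 : t + l <= 0 by rewrite tl pmulr_lle0 ?invr_gt0//; lra.
  have Pz : P <= iter n z (L + b0 * t).
    rewrite (le_trans PZ)// (iter_le zP) /t [b0 * _]mulrC divfK//; lra.
  have Py : P <= iter n y (L + b0 * (t + l)).
    rewrite (le_trans PY)// (iter_le yP) tl [b0 * _]mulrC divfK//; lra.
  have := congr1 (@^~ (cls0 t)) yz; rewrite /= rotC0E.
  rewrite (matherZ t0 Pz) (matherY tl0 Py) rotC1E => /cls1_eqP.
  rewrite tl /t ![b0 * _]mulrC !divfK// ![L + _]addrC !subrK.
  by congr (_ \is a _); field.
have int0 := int_diff (A - b0); have intx := int_diff x.
have : (iter n z (x + c) - iter n y x - (Z0 - Y0)) / b1 \is a Num.int.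
  rewrite (_ : _ / _ = ((iter n z (x + c) - iter n y x) / b1 + m) -
    ((Z0 - Y0) / b1 + m)); last by field.
  by rewrite rpredB ?int0 ?intx//; lra.
(* Both increments lie in [[0, b1[], so the integer found above lies strictly between -1 and 1. *)
have Y1 : Y0 <= iter n y x by rewrite (iter_le yP).
have Y2 : iter n y x < Y0 + b1 by rewrite -YA (iter_lt yP).
have Z1 : Z0 <= iter n z (x + c) by rewrite (iter_le zP) lerD2r.
have Z2 : iter n z (x + c) < Z0 + b1 by rewrite -ZA (iter_lt zP) ltrD2r.
move=> /intrP[k kE].
have k1 : k < 1 by rewrite -(ltr_int K) -kE ltr_pdivrMr//; lra.
have k2 : -1 < k by rewrite -(ltr_int K) -kE ltr_pdivlMr//; lra.
have k0 : k = 0 by move: k1 k2; clear; lia.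
move: kE; rewrite k0 => /eqP; rewrite mulf_eq0 invr_eq0 (negPf b1') orbF => /eqP.
lra.
Qed.

Lemma mather_conjugate (l m : K) :
  rotC1 N m \o mather N zbar = mather N ybar \o rotC0 l -> conjugate_in_H y z.
Proof.
have b0p := b0_gt0; have b1p := b1_gt0.
move=> /mather_lift[c [d [A [n [AL AcL RY RZ zyd]]]]].
have ynH : monodH (iter n y) by exact/monodH_iter/yP.1.
have znH : monodH (iter n z) by exact/monodH_iter/zP.1.
(* [B] is the left end of the domain's image under [iter n y]; on that whole image [g t] and [t + d]
   agree by [zyd]. *)
pose B := iter n y (A - b0).
pose g := iter n z \o (+%R^~ c) \o inverse (iter n y).
have gE x : g (iter n y x) = iter n z (x + c) by rewrite /g /= (monodHK ynH).
have Bd : B + d = iter n z (A - b0 + c) by rewrite zyd//; lra.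
apply/conjugate_in_HP; exists (fun t => if t <= B then g t else t + d).
  apply: monodH_glue; last by rewrite gE Bd.
    apply: monodH_comp (monodH_inverse ynH).
    exact: monodH_comp znH (monodH_translation c).
  exact: monodH_translation.
(* Beyond [B] both maps translate by [b1], since [B] and [B + d] are at least [R]. *)
apply/funext => t /=; have [tB|Bt] := leP t B; last first.
  rewrite leNgt (lt_trans Bt (yP.2 t)) /= yR; last exact: le_trans (ltW Bt).
  by rewrite zR; [ring|rewrite -Bd in RZ; lra].
have [x xt] : exists x, iter n y x = t.
  by exists (inverse (iter n y) t); rewrite (monodHKV ynH).
move: tB; rewrite -xt (iter_le yP) => xA.
have -> : y (iter n y x) = iter n y (x + b0) by rewrite -iterS iterSr yL//; lra.
rewrite !gE -iterS iterSr zL; last lra.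
have -> : x + c + b0 = x + b0 + c by ring.
(* If [y] carries the point across [B], then [x + b0] lies in the fundamental domain, where the two
   formulas agree. *)
by rewrite (iter_le yP); case: ifPn => // xb; rewrite zyd//; lra.
Qed.

End MatherInvariantComplete.

Theorem theorem4p2 (K : realType) (y z : K -> K) (L R b0 b1 : K) (N : nat)
  (hy : monodH_pos y) (hz : monodH_pos z)
  (hLR : L < R) (hb0 : 0 < b0) (hb1 : 0 < b1)
  (hyL : forall t : K, t <= L -> y t = t + b0)
  (hzL : forall t : K, t <= L -> z t = t + b0)
  (hyR : forall t : K, R <= t -> y t = t + b1)
  (hzR : forall t : K, R <= t -> z t = t + b1)
  (hN0 : (0 < N)%N)
  (hN : iter N y @` `]inverse y L, L[ `|` iter N z @` `]inverse z L, L[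
          `<=` `]R, +oo[) :
  let s := chart y L b0 b1 N in
  let ybar := s \o y \o inverse s in
  let zbar := s \o z \o inverse s in
  conjugate_in_H y z <->
  exists l m : K, rotC1 N m \o mather N zbar = mather N ybar \o rotC0 l.
Proof.
have yN : R <= iter N.-1 y L.
  by apply: (fundamental_domain_escape hy hb0 hyL hN0) => u yu; apply: hN; left.
have zN : R <= iter N.-1 z L.
  by apply: (fundamental_domain_escape hz hb0 hzL hN0) => u zu; apply: hN; right.
split=> [|[l [m]]].
  exact: (conjugate_mather hy hz hb0 hb1 hyL hzL hyR hzR yN zN).
exact: (mather_conjugate hy hz hb0 hb1 hyL hzL hyR hzR yN zN).
Qed.
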